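(* Let $n \geq 2$ and let $\kappa_1 \geq \kappa_2 \geq \cdots \geq \kappa_n$ be nonnegative integers. Then the partition polytope $\mathrm{PP}(\kappa_1, \ldots, \kappa_n)$ has combinatorial diameter at most $\kappa_1 + \lceil \kappa_2/2 \rceil$.
   Context: For nonnegative integers $\kappa_1,\dots,\kappa_n$ with $m = \kappa_1+\cdots+\kappa_n$, the partition polytope $\mathrm{PP}(\kappa_1,\dots,\kappa_n)\subseteq\mathbb{R}^{nm}$ is the set of all real $n\times m$ matrices $(y_{ij})$ satisfying $\sum_{j=1}^m y_{ij}=\kappa_i$ for all $1\le i\le n$, $\sum_{i=1}^n y_{ij}=1$ for all $1\le j\le m$, and $y_{ij}\ge 0$ for all $i,j$. The (combinatorial) diameter of a polytope is the diameter of its edge graph, i.e. the graph whose vertices are the vertices of the polytope and whose edges are the one-dimensional faces of the polytope; the diameter of a connected graph is the maximum, over all pairs of vertices, of the length of a shortest path between them. *)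

(* Defs.v *)
From HB Require Import structures.
From mathcomp Require Import all_boot all_order all_algebra.
From mathcomp Require Import boolp classical_sets reals.

Set Implicit Arguments.
Unset Strict Implicit.
Unset Printing Implicit Defensive.

Import Order.TTheory GRing.Theory Num.Theory.
Local Open Scope ring_scope.
Local Open Scope classical_set_scope.

Section Faces.
Context {R : realType} {V : vectType R}.
Implicit Types (P F S : set V) (u v : V).

(* The intersection of P with {x | c x = b}, for an inequality c x <= b valid
   on P.  The trivial inequality makes P a face of itself; set0 may also be a
   face. *)
Definition face P F : Prop :=
  exists (c : {scalar V}) (b : R),
    (forall x, P x -> c x <= b) /\ F = [set x | P x /\ c x = b].

(* The dimension of the affine hull of S, i.e. of the smallest linear subspace
   containing all differences of points of S; no k qualifies if S is empty. *)
Definition has_affine_dim S (k : nat) : Prop :=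
  S !=set0 /\
  exists U : {vspace V},
    [/\ \dim U = k,
        forall x y, S x -> S y -> x - y \in U &
        forall W : {vspace V},
          (forall x y, S x -> S y -> x - y \in W) -> (U <= W)%VS].

Definition vertices P : set V :=
  [set v | exists F, [/\ face P F, has_affine_dim F 0 & F v]].

Definition edge_adj P : rel V := fun u v =>
  `[< [/\ vertices P u, vertices P v, u <> v &
       exists F, [/\ face P F, has_affine_dim F 1, F u & F v]] >].

End Faces.

Section GraphDiameter.
Context {T : Type}.
Implicit Types (A : set T) (e : rel T) (u v : T).

Definition walk e u v (k : nat) : Prop :=
  exists s : seq T, [/\ size s = k, path e u s & last u s = v].

Definition graph_distance e u v (k : nat) : Prop :=
  walk e u v k /\ forall l, walk e u v l -> (k <= l)%N.

(* No D qualifies unless the graph e on the vertex set A is nonempty,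
   connected and of finite diameter.  The relation e is expected to relate only
   points of A. *)
Definition graph_diameter A e (D : nat) : Prop :=
  (forall u v, A u -> A v -> exists2 k, graph_distance e u v k & (k <= D)%N) /\
  (exists u v, [/\ A u, A v & graph_distance e u v D]).

End GraphDiameter.

Definition combinatorial_diameter {R : realType} {V : vectType R} (P : set V)
    (D : nat) : Prop :=
  graph_diameter (vertices P) (edge_adj P) D.

Definition partition_polytope (R : realType) (n : nat) (kappa : 'I_n -> nat) :
    set 'M[R]_(n, (\sum_(i < n) kappa i)%N) :=
  [set y | [/\ forall i, \sum_j y i j = (kappa i)%:R,
               forall j, \sum_i y i j = 1 &
               forall i j, 0 <= y i j]].

Arguments partition_polytope R {n} kappa _ : rename.

(* Main.v *)
Require Import Defs.
From HB Require Import structures.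
From mathcomp Require Import boolp classical_sets reals.
From mathcomp Require Import all_boot all_order all_algebra fingroup perm.
From mathcomp Require Import zify ring lra.

(** Vertices of the partition polytope are the assignments of [m] items to [n]
    clusters with prescribed cluster sizes, and moving one item along each edge
    of a simple cycle of clusters (an exchange) gives an adjacent vertex, or
    the same one ([vertex_is_clustering], [exchange_edge]).  It remains to lead
    any assignment [f] to any other assignment [g] by few exchanges.

    Call the excess of a cluster the number of items that have to leave it; as
    many have to enter it.  If all excesses are at most [D], the items to be
    moved form a bipartite graph of maximal degree [D] between source and target
    clusters, and Hall's theorem yields a permutation of the clusters, with one
    item to move along each of its nontrivial arcs, that involves all clusters
    of excess [D] ([exists_shift]).  Performing it lowers the maximal excess.
    Such a permutation consists of disjoint cycles.  A single exchange through
    all of these, concatenated into one cycle, misplaces just one item per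
    cycle, and a second exchange repairs this; so one permutation costs two
    exchanges.

    The saving comes from handling two permutations together in three exchanges
    ([merge_three], [shift_three]).  The first one is concatenated and repaired
    afterwards, the second one is prepared beforehand and then concatenated, and
    repair and preparation share the exchange in the middle.  For this the
    repair and the preparation must use different clusters, one from each cycle
    of the two permutations.  Such representatives exist by Hall's theorem,
    since every cycle has at least two clusters and every cluster lies in at
    most two cycles ([disjoint_transversals]).  Hence excesses bounded by [D]
    are removed in [D + uphalf D] exchanges ([reach_excess]).

    Finally only the first cluster can have an excess larger than [kappa_2].
    While it does, a single cycle of the permutation, the one through this
    cluster, lowers its excess at the price of one exchange.  This happens at
    most [kappa_1 - kappa_2] times ([reach_excess_one]), and the total is
    [(kappa_1 - kappa_2) + kappa_2 + uphalf kappa_2]. *)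

Set Implicit Arguments.
Unset Strict Implicit.
Unset Printing Implicit Defensive.

Import Order.TTheory GRing.Theory Num.Theory.

(** * Systems of distinct representatives *)

Section Hall.
Context {J I : finType} (r : J -> I -> bool) (h0 : J -> I).

Definition nbhd (B : {set I}) (S : {set J}) :=
  [set i in B | [exists j in S, r j i]].

(** Hall's marriage theorem.  If some nonempty proper subset [S] of [A] is tight,
    [S] must use up all of its neighbours, and what remains still satisfies
    Hall's condition; if there is none, one pair can be married arbitrarily,
    since each other subset loses at most one neighbour and had one to
    spare. *)
Lemma hall (A : {set J}) (B : {set I}) :
  (forall S : {set J}, S \subset A -> #|S| <= #|nbhd B S|) ->
  exists h : J -> I, {in A &, injective h} /\
    forall j, j \in A -> h j \in B /\ r j (h j).
Proof.
move: {2}#|A| (leqnn #|A|) => k; elim: k A B => [|k IH] A B.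
  rewrite leqn0 cards_eq0 => /eqP-> _; exists h0.
  by split=> [j j'|j]; rewrite inE.
move=> leAk hallA.
have [/existsP[S /and4P[SA S0 SnA tight]]|] := boolP [exists S : {set J},
  [&& S \subset A, S != set0, S != A & #|nbhd B S| <= #|S|]].
- have ltSA : #|S| < #|A| by apply: proper_card; rewrite properEneq SnA.
  have [|S' S'S|h1 [inj1 h1P]] := IH S B; first by lia.
    by apply: hallA; apply: subset_trans SA.
  have [||h2 [inj2 h2P]] := IH (A :\: S) (B :\: nbhd B S).
  - have := cardsID S A; rewrite (setIidPr SA); move: S0; rewrite -card_gt0; lia.
  - move=> S' S'A.
    have S'S : [disjoint S & S'].
      rewrite disjoint_sym disjoints_subset; apply: subset_trans S'A _.
      by apply/subsetP=> j; rewrite !inE => /andP[].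
    have /hallA : S :|: S' \subset A.
      by rewrite subUset SA (subset_trans S'A) // subsetDl.
    rewrite cardsU (disjoint_setI0 S'S) cards0 subn0 => le1.
    have : nbhd B (S :|: S') \subset nbhd B S :|: nbhd (B :\: nbhd B S) S'.
      apply/subsetP=> i; rewrite !inE => /andP[iB /existsP[j /andP[]]].
      rewrite iB inE /= => jSS' rji.
      case: (boolP [exists j in S, r j i]) => //= notS.
      apply/existsP; exists j; rewrite rji andbT.
      case/orP: jSS' => // jS; case/negP: notS; apply/existsP; exists j.
      by rewrite jS.
    by move/subset_leq_card; rewrite cardsU; lia.
  have h1N j : j \in S -> h1 j \in nbhd B S.
    move=> jS; have [hB rh] := h1P j jS; rewrite inE hB /=.
    by apply/existsP; exists j; rewrite jS.
  have h2N j : j \in A -> j \notin S -> h2 j \notin nbhd B S.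
    move=> jA jS; have [|] := h2P j; first by rewrite inE jA jS.
    by rewrite inE => /andP[].
  exists (fun j => if j \in S then h1 j else h2 j); split=> [j j' jA j'A|j jA].
    have [jS|jS] := boolP (j \in S); have [j'S|j'S] := boolP (j' \in S).
    + exact: inj1.
    + by move=> e; case/negP: (h2N j' j'A j'S); rewrite -e h1N.
    + by move=> e; case/negP: (h2N j jA jS); rewrite e h1N.
    + by apply: inj2; rewrite inE ?jS ?j'S.
  have [jS|jS] := boolP (j \in S); first exact: h1P.
  have [|] := h2P j; first by rewrite inE jS.
  by rewrite inE => /andP[].
move=> /existsPn loose.
have [->|/set0Pn[j jA]] := eqVneq A set0.
  by exists h0; split=> [j j'|j]; rewrite inE.
have /hallA : [set j] \subset A by rewrite sub1set.
rewrite cards1 card_gt0 => /set0Pn[i]; rewrite inE => /andP[iB].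
move=> /existsP[j1 /andP[/set1P-> rji]].
have [||h [injh hP]] := IH (A :\ j) (B :\ i).
- by have := cardsD1 j A; rewrite jA; lia.
- move=> S SA; have [->|S0] := eqVneq S set0; first by rewrite cards0.
  have SA' : S \subset A by apply: subset_trans SA _; apply: subsetDl.
  have SnA : S != A.
    apply/eqP=> eSA; move/subsetP: SA => /(_ j); rewrite eSA => /(_ jA).
    by rewrite !inE eqxx.
  have := loose S; rewrite SA' S0 SnA /= -ltnNge => lt1.
  have : nbhd B S :\ i \subset nbhd (B :\ i) S.
    by apply/subsetP=> i'; rewrite !inE => /and3P[-> -> ->].
  move/subset_leq_card; have := cardsD1 i (nbhd B S); lia.
have hj j' : j' \in A -> j' != j -> h j' != i.
  by move=> j'A ne; have [|] := hP j'; rewrite ?inE ?ne // => /andP[].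
exists (fun j' => if j' == j then i else h j').
split=> [j' j'' j'A j''A|j' j'A].
  have [->|n1] := eqVneq j' j; have [->|n2] := eqVneq j'' j => // e.
  - by case/eqP: (hj _ j''A n2).
  - by case/eqP: (hj _ j'A n1).
  - by apply: injh; rewrite ?inE ?n1 ?n2.
have [->|n1] := eqVneq j' j; first by [].
by have [|] := hP j'; rewrite ?inE ?n1 // => /andP[].
Qed.

End Hall.

(** Double counting: every [j] sees at least two points and every point is seen
    at most twice, so Hall's condition holds for the whole of [I].  If at most
    one incidence is lost by forbidding the points outside [B], then
    [2 * #|S| <= 2 * #|nbhd r B S| + 1], and parity absorbs the loss. *)
Lemma hall_degree2 (J I : finType) (r : J -> I -> bool) (h0 : J -> I)
    (A : {set J}) (B : {set I}) :
  (forall j, j \in A -> 1 < #|[set i | r j i]|) ->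
  (forall i, #|[set j in A | r j i]| <= 2) ->
  \sum_(i in ~: B) #|[set j in A | r j i]| <= 1 ->
  exists h : J -> I, {in A &, injective h} /\
    forall j, j \in A -> h j \in B /\ r j (h j).
Proof.
move=> deg2 occ2 loss; apply: hall => // S SA.
have count (X : {set I}) : \sum_(i in X) #|[set j in S | r j i]| =
    \sum_(j in S) #|[set i in X | r j i]|.
  under eq_bigr do rewrite -sum1dep_card.
  under [RHS]eq_bigr do rewrite -sum1dep_card.
  rewrite (exchange_big_dep (mem S)) /=; last by move=> i j _ /andP[].
  by apply: eq_bigr => j jS; apply: eq_bigl => i; rewrite jS.
have leSA i : #|[set j in S | r j i]| <= #|[set j in A | r j i]|.
  apply: subset_leq_card; apply/subsetP=> j; rewrite !inE.
  by case/andP=> /(subsetP SA)-> ->.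
have total : 2 * #|S| <= \sum_(i in [set: I]) #|[set j in S | r j i]|.
  rewrite count -sum1_card big_distrr /=; apply: leq_sum => j jS.
  have := deg2 j (subsetP SA j jS); congr (_ < _); apply: eq_card => i.
  by rewrite !inE.
have split : \sum_(i in [set: I]) #|[set j in S | r j i]| =
  \sum_(i in B) #|[set j in S | r j i]| + \sum_(i in ~: B) #|[set j in S | r j i]|.
  rewrite (bigID (mem B)) /=; congr (_ + _); apply: eq_bigl => i.
    by rewrite inE.
  by rewrite !inE.
have lossS : \sum_(i in ~: B) #|[set j in S | r j i]| <= 1.
  by apply: leq_trans loss; apply: leq_sum.
have gain : \sum_(i in B) #|[set j in S | r j i]| <= 2 * #|nbhd r B S|.
  rewrite (bigID (fun i => i \in nbhd r B S)) /= [X in _ + X]big1 ?addn0.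
    rewrite -sum1_card big_distrr /=.
    rewrite [X in _ <= X](eq_bigl (fun i => (i \in B) && (i \in nbhd r B S))).
      by apply: leq_sum => i _; apply: leq_trans (occ2 i).
    by move=> i; rewrite !inE andbA andbb.
  move=> i /andP[iB]; rewrite inE iB /= => /existsPn ni.
  apply/eqP; rewrite cards_eq0; apply/eqP/setP=> j; rewrite !inE.
  by apply/negbTE/ni.
lia.
Qed.

(** The support of a weighted bipartite graph with constant weight on one side:
    the weight [a * #|S|] leaving [S] cannot exceed the capacity
    [a * #|nbhd S|] of its neighbours, which is Hall's condition.  It serves
    both the real points of the polytope and the integer matrices that count
    items. *)
Lemma injection_in_support (R : realDomainType) (I J : finType) (a : R)
    (A : I -> J -> R) : (0 < a)%R -> (forall i j, (0 <= A i j)%R) ->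
  (forall j, (\sum_i A i j)%R = a) -> (forall i, (\sum_j A i j <= a)%R) ->
  exists2 h : J -> I, injective h & forall j, (0 < A (h j) j)%R.
Proof.
move=> a0 A0 colA rowA.
have pos j : exists i, (0 < A i j)%R.
  apply/existsP; apply: contraLR a0 => /existsPn n; rewrite -(colA j) -leNgt.
  by apply: sumr_le0 => i _; rewrite leNgt.
have [|h [injh hP]] := @hall J I (fun j i => (0 < A i j)%R)
  (fun j => xchoose (pos j)) [set: J] [set: I].
  move=> S _; rewrite -(ler_nat R) -(ler_pM2r a0).
  set N := nbhd _ _ _.
  have -> : (#|S|%:R * a = \sum_i \sum_(j in S) A i j)%R.
    rewrite exchange_big /= (eq_bigr (fun=> a)) => [|j _]; last exact: colA.
    by rewrite sumr_const mulr_natl.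
  rewrite (bigID (mem N)) /= [X in (_ + X)%R]big1 ?addr0.
    rewrite mulr_natl -sumr_const; apply: ler_sum => i _.
    apply: le_trans (rowA i); rewrite [leRHS](bigID (mem S)) /= lerDl.
    exact: sumr_ge0.
  move=> i; rewrite !inE /= => /existsPn ni; apply: big1 => j jS.
  by apply/eqP; move: (ni j); rewrite jS /= lt0r A0 andbT negbK.
exists h => [j j' e|j]; first by apply: injh.
by have [] := hP j (in_setT _).
Qed.

(** * Merging cycles given as lists *)

Section CyclicLists.
Context {T : finType} (x0 : T).
Implicit Types (x y : T) (s t : seq T) (xss yss : seq (seq T)).

Lemma next_at_cat s t x y0 y z :
  next_at x y0 y (s ++ z :: t) =
  if x \in y :: s then next_at x z y s else next_at x y0 z t.
Proof.
elim: s y => [|w s IH] y /=; first by rewrite inE; case: (x == y).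
by rewrite IH [in RHS]in_cons; case: (x == y).
Qed.

Lemma next_at_last s x y z z' : uniq (y :: s) -> x \in y :: s ->
  next_at x z y s = if x == last y s then z else next_at x z' y s.
Proof.
elim: s y => [|w s IH] y; first by rewrite /= inE => _ ->.
case/andP=> yws uws; rewrite inE /=; case: eqVneq => [->|_ /= xws].
  case: eqVneq => // e; case/negP: yws; rewrite e; exact: mem_last.
exact: IH.
Qed.

Lemma next_notin s x : x \notin s -> next s x = x.
Proof. by move=> xs; rewrite next_nth (negPf xs). Qed.

Lemma next_last s : s != [::] -> uniq s -> next s (last x0 s) = head x0 s.
Proof.
case: s => // y s _ us /=.
by rewrite (next_at_last y y us) ?mem_last ?eqxx.
Qed.

Lemma mem_last_nonempty s : s != [::] -> last x0 s \in s.
Proof. by case: s => // y s _ /=; apply: mem_last. Qed.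

Lemma mem_head_nonempty s : s != [::] -> head x0 s \in s.
Proof. by case: s => // y s _ /=; apply: mem_head. Qed.

Lemma if_eq_id x y : (if x == y then y else x) = x.
Proof. by case: eqVneq. Qed.

Lemma next_inj s : uniq s -> injective (next s).
Proof. by move=> us; apply: can_inj (prev_next us). Qed.

Lemma next_cat s t x : s != [::] -> t != [::] -> uniq (s ++ t) ->
  next (s ++ t) x =
  if x == last x0 s then head x0 t else if x == last x0 t then head x0 s
  else if x \in s then next s x else next t x.
Proof.
case: s => // y s _; case: t => // z t _.
rewrite cat_uniq => /and3P[us dis ut] /=.
rewrite next_at_cat; case: ifP => xs.
  rewrite (next_at_last z y us xs); case: eqVneq => // _.
  case: eqVneq => // e; case/hasP: dis; exists x => //.
  by rewrite e; apply: mem_last.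
case: eqVneq => [e|_]; first by rewrite e mem_last in xs.
case: (boolP (x \in z :: t)) => xt.
  by rewrite (next_at_last y z ut xt).
have nt w : next_at x w z t = x.
  elim: (t) (z) xt => [|u t' IH] z' /=; first by rewrite mem_seq1 => /negPf->.
  by rewrite in_cons => /norP[/negPf-> /IH].
by rewrite !nt; case: eqVneq => // e; rewrite e mem_last in xt.
Qed.

(** Concatenating two cycles merges them into one, which costs a transposition.
    There are two ways to write it: on the right it swaps the last entries,
    before the cycles act; on the left, in [next_cat_head], it swaps the heads,
    after they have acted. *)
Lemma next_cat_last s t : s != [::] -> t != [::] -> uniq (s ++ t) ->
  next (s ++ t) =1 next s \o next t \o tperm (last x0 s) (last x0 t).
Proof.
move=> s0 t0 ust x; rewrite next_cat //.
move: ust; rewrite cat_uniq => /and3P[us dis ut].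
have nst y : y \in t -> y \notin s.
  by move=> yt; apply/negP=> ys; case/hasP: dis; exists y.
have [hs ht] := (mem_last_nonempty s0, mem_last_nonempty t0).
rewrite /=; case: tpermP => [->|->|/eqP xs /eqP xt].
- by rewrite eqxx next_last // next_notin // nst // mem_head_nonempty.
- rewrite eqxx [next t _]next_notin ?next_last //; last first.
    by apply/negP=> /nst; rewrite hs.
  by case: eqVneq => // e; move: (nst _ ht); rewrite e hs.
- rewrite (negPf xs) (negPf xt); case: ifP => [xins|xnins].
    by rewrite [next t _]next_notin //; apply/negP=> /nst; rewrite xins.
  rewrite [next s _]next_notin //; have [xint|xnint] := boolP (x \in t).
    by apply: nst; rewrite mem_next.
  by rewrite next_notin ?xnins.
Qed.

Lemma next_cat_head s t : s != [::] -> t != [::] -> uniq (s ++ t) ->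
  next (s ++ t) =1 tperm (head x0 s) (head x0 t) \o next s \o next t.
Proof.
move=> s0 t0 ust x; rewrite next_cat //.
move: ust; rewrite cat_uniq => /and3P[us dis ut].
have nst y : y \in t -> y \notin s.
  by move=> yt; apply/negP=> ys; case/hasP: dis; exists y.
have nts y : y \in s -> y \notin t.
  by move=> ys; apply/negP=> yt; case/hasP: dis; exists y.
have [ls lt] := (mem_last_nonempty s0, mem_last_nonempty t0).
have [hs ht] := (mem_head_nonempty s0, mem_head_nonempty t0).
case: eqVneq => [->|xs] /=.
  by rewrite [next t _]next_notin ?nts // next_last // tpermL.
case: eqVneq => [->|xt] /=.
  by rewrite next_last // next_notin ?nst // tpermR.
have nhs y : next s y = head x0 s -> y = last x0 s.
  by rewrite -next_last // => /(next_inj us).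
have nht y : next t y = head x0 t -> y = last x0 t.
  by rewrite -next_last // => /(next_inj ut).
case: ifP => [xins|xnins].
  rewrite [next t _]next_notin ?nts // tpermD //.
    by apply/eqP=> /esym/nhs /eqP; rewrite (negPf xs).
  apply/eqP=> e; move: (nts (next s x)); rewrite mem_next xins -e ht.
  by move/(_ isT).
have nns : next t x \notin s.
  have [xint|xnint] := boolP (x \in t); first by apply: nst; rewrite mem_next.
  by rewrite next_notin ?xnins.
rewrite [next s _]next_notin // tpermD //.
  by apply/eqP=> e; rewrite -e hs in nns.
by apply/eqP=> /esym/nht /eqP; rewrite (negPf xt).
Qed.

Definition cycles xss : T -> T := foldr (fun s h => next s \o h) id xss.

Lemma cycles_notin xss x : x \notin flatten xss -> cycles xss x = x.
Proof.
elim: xss => //= s xss IH; rewrite mem_cat => /norP[xs /IH ->].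
exact: next_notin.
Qed.

Lemma cycles_in xss s x : uniq (flatten xss) -> s \in xss -> x \in s ->
  cycles xss x = next s x.
Proof.
elim: xss => //= t xss IH; rewrite cat_uniq => /and3P[ut dis uxss].
rewrite inE => /orP[/eqP e|sxss] xs; first subst t.
  by rewrite cycles_notin //; apply/negP=> xf; case/hasP: dis; exists x.
rewrite (IH uxss sxss xs) next_notin //; apply/negP=> xt.
case/hasP: dis; exists (next s x) => //.
by apply/flattenP; exists s; rewrite ?mem_next.
Qed.

Lemma cycles_cat xss yss : cycles (xss ++ yss) =1 cycles xss \o cycles yss.
Proof. by elim: xss => //= s xss IH x /=; rewrite IH. Qed.

Lemma flatten_nonempty xss : xss != [::] -> all (predC1 [::]) xss ->
  flatten xss != [::].
Proof. by case: xss => //= s xss _ /andP[]; case: s. Qed.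

Lemma uniq_lasts xss : all (predC1 [::]) xss -> uniq (flatten xss) ->
  uniq (map (last x0) xss).
Proof.
move=> nx; apply: subseq_uniq; elim: xss nx => //= s xss IH /andP[s0 /IH sub].
rewrite -cat1s; apply: cat_subseq => //.
by rewrite sub1seq mem_last_nonempty.
Qed.

Lemma uniq_heads xss : all (predC1 [::]) xss -> uniq (flatten xss) ->
  uniq (map (head x0) xss).
Proof.
move=> nx; apply: subseq_uniq; elim: xss nx => //= s xss IH /andP[s0 /IH sub].
rewrite -cat1s; apply: cat_subseq => //.
by rewrite sub1seq mem_head_nonempty.
Qed.

(** [next_cat_last] iterated: the transpositions compose to a cycle that touches
    a single entry, the last one, of each list. *)
Lemma next_flatten_last xss : all (predC1 [::]) xss -> uniq (flatten xss) ->
  next (flatten xss) =1 cycles xss \o next (map (last x0) xss).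
Proof.
elim: xss => //= s xss IH /andP[s0 nxss] us x.
have uxss : uniq (flatten xss) by move: us; rewrite cat_uniq => /and3P[].
have [->|xss0] := eqVneq xss [::]; first by rewrite /= cats0 if_eq_id.
rewrite -[last x0 s :: _]cat1s.
have ul : uniq (map (last x0) (s :: xss)) by rewrite uniq_lasts //= s0.
rewrite next_cat_last ?flatten_nonempty // [in RHS]/comp.
rewrite [in RHS]next_cat_last //; last by case: (xss) xss0.
rewrite /= IH //= if_eq_id; congr (next s (cycles xss (next _ (tperm _ _ x)))).
move: xss0 nxss; elim: (xss) {-3}x0 => //= t xs IHx w _ /andP[t0 nxs].
rewrite last_cat; have -> : last w t = last x0 t by case: (t) t0.
by case: (xs) IHx nxs => // t' xs' /(_ (last x0 t) isT) IHx /IHx.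
Qed.

(** The mirror image of [next_flatten_last], with the correction applied after
    the cycles instead of before them. *)
Lemma next_flatten_head xss : all (predC1 [::]) xss -> uniq (flatten xss) ->
  next (flatten xss) =1 next (map (head x0) xss) \o cycles xss.
Proof.
elim: xss => //= s xss IH /andP[s0 nxss] us x.
have uxss : uniq (flatten xss) by move: us; rewrite cat_uniq => /and3P[].
have [->|xss0] := eqVneq xss [::]; first by rewrite /= cats0 if_eq_id.
rewrite -[head x0 s :: _]cat1s.
have ul : uniq (map (head x0) (s :: xss)) by rewrite uniq_heads //= s0.
rewrite next_cat_head ?flatten_nonempty // [in RHS]/comp.
rewrite [in RHS]next_cat_head //; last by case: (xss) xss0.
rewrite /= IH //= if_eq_id.
have -> : head x0 (flatten xss) = head x0 (map (head x0) xss).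
  by case: (xss) xss0 nxss => //= t xs _ /andP[]; case: t.
congr (tperm _ _ _).
(* The heads of the other cycles do not occur in s. *)
have dis y : y \in s -> y \notin flatten xss.
  move=> ys; move: us; rewrite cat_uniq => /and3P[_ /hasPn d _].
  by apply/negP=> /d; rewrite /= ys.
have hsub y : y \in map (head x0) xss -> y \in flatten xss.
  case/mapP=> t txss ->; apply/flattenP; exists t => //.
  by apply: mem_head_nonempty; apply: (allP nxss).
set z := cycles xss x.
have [zs|zs] := boolP (z \in s).
  rewrite [next _ z]next_notin; last by apply: contra (dis _ zs) => /hsub.
  rewrite [RHS]next_notin //; apply/negP=> /hsub; apply/negP/dis.
  by rewrite mem_next.
rewrite (next_notin zs) next_notin //.
have [zh|zh] := boolP (z \in map (head x0) xss); last by rewrite next_notin.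
by apply/negP=> /dis; rewrite (hsub _) // mem_next.
Qed.

Lemma next_rev_cancel s : uniq s -> next s \o next (rev s) =1 id.
Proof. by move=> us x /=; rewrite next_rev // next_prev. Qed.

Lemma next_rev_cancel' s : uniq s -> next (rev s) \o next s =1 id.
Proof. by move=> us x /=; rewrite next_rev // prev_next. Qed.

Lemma next_flatten_lasts_heads xss x :
  all (predC1 [::]) xss -> uniq (flatten xss) -> x \in map (last x0) xss ->
  next (flatten xss) x \in map (head x0) xss.
Proof.
move=> nxss us /mapP[s sxss ->]; rewrite next_flatten_head //= mem_next.
have s0 := allP nxss s sxss.
have uS : uniq s.
  elim: (xss) us sxss => //= t xs IH; rewrite cat_uniq => /and3P[ut _ uxs].
  by rewrite inE => /orP[/eqP->|/(IH uxs)].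
rewrite (cycles_in us sxss) ?mem_last_nonempty // next_last //.
exact: map_f.
Qed.

End CyclicLists.

(** * Performing families of disjoint cycles *)

Section Steps.
Context {T I : finType}.
Implicit Types (f g : T -> I).

(** An assignment [f] sends items to clusters.  Precomposing with [next s] sends
    each item of [s] to the cluster of the item that follows it; as [s] has at
    most one item in each cluster, this moves one item along each edge of a
    simple cycle of clusters.  Lists of size at most one are allowed and
    change nothing. *)
Definition exchange f g := exists s, uniq (map f s) /\ g =1 f \o next s.

Lemma uniq_map_inj (A B : eqType) (f : A -> B) (s : seq A) :
  uniq (map f s) -> {in s &, injective f}.
Proof.
elim: s => //= a s IH /andP[nas us] x y.
rewrite !inE => /orP[/eqP->|xs] /orP[/eqP->|ys] // e.
- by case/negP: nas; rewrite e map_f.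
- by case/negP: nas; rewrite -e map_f.
- exact: IH.
Qed.

(** The first exchange runs through the concatenation of the cycles, after which
    only the last item of each list is misplaced; these items lie in the
    clusters of the list heads, hence in pairwise distinct clusters, and the
    second exchange rotates them back. *)
Lemma merge_two (x0 : T) f (xss : seq (seq T)) :
  all (predC1 [::]) xss -> uniq (map f (flatten xss)) ->
  exists2 f1, exchange f f1 & exchange f1 (f \o cycles xss).
Proof.
move=> nxss ufx; have ux := map_uniq ufx.
have uX := uniq_lasts x0 nxss ux.
exists (f \o next (flatten xss)); first by exists (flatten xss).
exists (rev (map (last x0) xss)); split.
  rewrite map_rev rev_uniq map_inj_in_uniq // => x y.
  have sub z : z \in map (last x0) xss -> z \in flatten xss.
    case/mapP=> s sx ->; apply/flattenP; exists s => //.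
    by apply: mem_last_nonempty; apply: (allP nxss).
  move=> /sub xin /sub yin /= e; apply: (next_inj ux).
  by apply: (uniq_map_inj ufx); rewrite ?mem_next.
by move=> x /=; rewrite (next_flatten_last x0) //= [next _ (next _ _)]next_rev_cancel.
Qed.

(** The first family of cycles is concatenated and corrected afterwards, at its
    last entries [X]; the second one is concatenated and corrected beforehand,
    at its heads [Y].  The two corrections share the middle exchange.  Since that exchange has to be a single cycle, the
    corrections themselves are concatenated, which interchanges one item [X0]
    of the first family with one item [Y0] of the second.  The third exchange
    therefore runs with [X0] in the place of [Y0], and the interchange that is
    left over is harmless because both items end up in the same cluster; this
    is what the last hypothesis provides. *)
Lemma merge_three (x0 : T) f (c0 e0 : seq T) (C E : seq (seq T)) :
  all (predC1 [::]) (c0 :: C) -> all (predC1 [::]) (e0 :: E) ->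
  uniq (map f (flatten (c0 :: C))) -> uniq (map f (flatten (e0 :: E))) ->
  uniq (flatten (c0 :: C) ++ flatten (e0 :: E)) ->
  uniq (map f (map (head x0) (c0 :: C) ++ map (head x0) (e0 :: E))) ->
  f (head x0 c0) = f (next e0 (head x0 e0)) ->
  exists f1 f2, [/\ exchange f f1, exchange f1 f2 &
    exchange f2 (f \o cycles (c0 :: C) \o cycles (e0 :: E))].
Proof.
move xE: (c0 :: C) => xss; move yE: (e0 :: E) => yss.
move=> nx ny ufx ufy uxy uh pE.
have ux := map_uniq ufx; have uy := map_uniq ufy.
have c0x : c0 \in xss by rewrite -xE mem_head.
have e0y : e0 \in yss by rewrite -yE mem_head.
have c00 : c0 != [::] := allP nx _ c0x.
have e00 : e0 != [::] := allP ny _ e0y.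
have xmem s : s \in xss -> {subset s <= flatten xss}.
  by move=> sx z zs; apply/flattenP; exists s.
have ymem s : s \in yss -> {subset s <= flatten yss}.
  by move=> sx z zs; apply/flattenP; exists s.
pose X := map (last x0) xss; pose Y := map (head x0) yss.
have uX : uniq X by apply: uniq_lasts.
have uY : uniq Y by apply: uniq_heads.
have Xsub : {subset X <= flatten xss}.
  move=> z /mapP[s sx ->]; apply: (xmem s sx).
  by apply: mem_last_nonempty; apply: (allP nx).
have Ysub : {subset Y <= flatten yss}.
  move=> z /mapP[s sx ->]; apply: (ymem s sx).
  by apply: mem_head_nonempty; apply: (allP ny).
have dxy z : z \in flatten xss -> z \notin flatten yss.
  move=> zx; apply/negP=> zy; move: uxy; rewrite cat_uniq => /and3P[_ d _].
  by case/hasP: d; exists z.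
have dyx z : z \in flatten yss -> z \notin flatten xss.
  by move=> zy; apply/negP=> /dxy; rewrite zy.
pose X0 := last x0 c0; pose Y0 := head x0 e0; pose h := tperm X0 Y0.
have hK z : h (h z) = z by rewrite tpermK.
have X0X : X0 \in X by apply: map_f.
have Y0Y : Y0 \in Y by apply: map_f.
pose b := rev X ++ rev Y.
have ub : uniq b.
  rewrite cat_uniq !rev_uniq uX uY andbT; apply/hasP=> -[z].
  by rewrite !mem_rev => /Ysub/dyx zn /Xsub; rewrite (negPf zn).
have bE : next b =1 next (rev X) \o next (rev Y) \o h.
  move=> z; rewrite (next_cat_last x0) //.
  - by rewrite /X /Y -xE -yE /= !rev_cons !last_rcons.
  - by rewrite /X -xE /= rev_cons -size_eq0 size_rcons.
  - by rewrite /Y -yE /= rev_cons -size_eq0 size_rcons.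
pose f1 := f \o next (flatten xss).
pose f2 := f1 \o next b.
have f2E : f2 =1 f \o cycles xss \o next (rev Y) \o h.
  move=> z; rewrite /f2 /f1 /= bE /= (next_flatten_last x0) //=.
  by rewrite [next _ (next _ _)]next_rev_cancel.
exists f1, f2; split.
- by exists (flatten xss).
(* After the first exchange, the items of X occupy clusters of heads of xss,
   while those of Y are still in the clusters of the heads of yss. *)
- exists b; split=> //; rewrite map_inj_in_uniq //.
  have f1X z : z \in X -> exists2 w, w \in map (head x0) xss & f1 z = f w.
    by move=> zX; exists (next (flatten xss) z) => //; apply: next_flatten_lasts_heads.
  have f1Y z : z \in Y -> f1 z = f z.
    by move=> /Ysub/dyx zn; rewrite /f1 /= next_notin.
  have fXY z w : z \in X -> w \in Y -> f1 z <> f1 w.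
    move=> /f1X[z' z'h ->] wY; rewrite (f1Y w wY) => e.
    have z'w : z' = w by apply: (uniq_map_inj uh); rewrite // mem_cat ?z'h ?wY ?orbT.
    move: uh => /map_uniq; rewrite cat_uniq => /and3P[_ /hasP d _].
    by apply: d; exists w; rewrite // -z'w.
  move=> z w; rewrite !mem_cat !mem_rev => /orP[zX|zY] /orP[wX|wY] e.
  + by apply: (next_inj ux); apply: (uniq_map_inj ufx); rewrite ?mem_next ?Xsub.
  + by case: (fXY z w).
  + by case: (fXY w z).
  + by move: e; rewrite !f1Y // => e; apply: (uniq_map_inj ufy); rewrite ?Ysub.
exists (map h (flatten yss)); split.
  rewrite -map_comp map_inj_in_uniq // => z w zy wy; rewrite /= !f2E /= !hK.
  have nY u : u \in flatten yss -> next (rev Y) u \in flatten yss.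
    move=> uyy; have [uYY|uYY] := boolP (u \in rev Y); last by rewrite next_notin.
    by apply: Ysub; rewrite -mem_rev mem_next.
  rewrite !cycles_notin ?dyx ?nY // => e.
  apply: (@next_inj _ (rev Y)); rewrite ?rev_uniq //.
  by apply: (uniq_map_inj ufy); rewrite ?nY.
move=> z; rewrite /= f2E /= -{2}[z]hK next_map //; last exact: perm_inj.
rewrite hK (next_flatten_head x0) //= [next _ (next _ _)]next_rev_cancel' //.
have X0E : f (cycles xss (cycles yss X0)) = f (head x0 c0).
  rewrite [cycles yss X0]cycles_notin ?dxy ?Xsub //.
  rewrite (cycles_in ux c0x (mem_last_nonempty _ c00)) next_last //.
  by move: ux; rewrite -xE /= cat_uniq => /and3P[].
have Y0E : f (cycles xss (cycles yss Y0)) = f (next e0 Y0).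
  rewrite (cycles_in uy e0y (mem_head_nonempty _ e00)) cycles_notin //.
  by rewrite dyx // (ymem e0) // mem_next mem_head_nonempty.
by rewrite /h; case: tpermP => // ->; rewrite X0E Y0E pE.
Qed.

End Steps.

(** * Transversals of the orbits of permutations *)

Section Transversal.
Context {I : finType}.
Implicit Types (s : {perm I}) (V : seq I).

(** [V] meets every nontrivial orbit of [s] exactly once and contains no fixed
    point. *)
Definition transversal s V :=
  uniq (flatten (map (orbit s) V)) /\
  forall i, (i \in flatten (map (orbit s) V)) = (s i != i).

Lemma fconnect_moved s v i : fconnect s v i -> (s i != i) = (s v != v).
Proof.
move=> vi; congr (~~ _).
have fix_conn w u : fconnect s w u -> s w == w -> u = w.
  move=> /iter_findex <- /eqP e; elim: (findex _ _ _) => //= n ->.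
  exact: e.
apply/idP/idP=> e.
  by rewrite (fix_conn i v) // fconnect_sym //; apply: perm_inj.
by rewrite (fix_conn v i).
Qed.

Lemma transversalP s V : uniq V -> {in V, forall v, s v != v} ->
  {in V &, forall v w, fconnect s v w -> v = w} ->
  (forall i, s i != i -> exists2 v, v \in V & fconnect s v i) ->
  transversal s V.
Proof.
move=> uV mV dV cV; split.
  have sym := fconnect_sym (@perm_inj _ s).
  elim: V uV {mV cV} dV => //= v V IH /andP[vV uV] dV.
  rewrite cat_uniq orbit_uniq IH //= ?andbT; last first.
    by move=> a b aV bV; apply: dV; rewrite inE ?aV ?bV orbT.
  apply/hasPn=> i /flatten_mapP[w wV]; rewrite -fconnect_orbit => wi.
  apply/negP; rewrite /= -fconnect_orbit => vi; case/negP: vV.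
  rewrite (dV v w) ?inE ?eqxx ?wV ?orbT //.
  by apply: connect_trans vi _; rewrite sym.
move=> i; apply/flatten_mapP/idP=> [[v vV]|].
  by rewrite -fconnect_orbit => /fconnect_moved->; apply: mV.
by move=> /cV[v vV vi]; exists v; rewrite // -fconnect_orbit.
Qed.

Lemma exists_transversal s : exists V, transversal s V.
Proof.
exists [seq i <- enum I | (froot s i == i) && (s i != i)].
have sym := fconnect_sym (@perm_inj _ s).
apply: transversalP.
- by rewrite filter_uniq ?enum_uniq.
- by move=> v; rewrite mem_filter => /andP[/andP[]].
- move=> v w; rewrite !mem_filter => /andP[/andP[/eqP rv _] _].
  by move=> /andP[/andP[/eqP rw _] _]; rewrite -root_connect // rv rw => /eqP.
- move=> i mi; exists (froot s i); last by rewrite sym connect_root.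
  rewrite mem_filter mem_enum inE andbT (root_root sym) eqxx /=.
  by rewrite (fconnect_moved (connect_root _ _)).
Qed.

(** Every nontrivial orbit has at least two points, and a point lies in at most one
    orbit of each permutation, so [hall_degree2] applies.  The representatives
    [p] and [q] are imposed on two orbits.  Forbidding them to the other orbits
    loses at most one incidence: both orbits through [p] are already served,
    and so is the orbit of [q] under [t], which leaves only the orbit of [q]
    under [s]. *)
Lemma disjoint_transversals (s t : {perm I}) (p q : I) :
  s p != p -> t p != p -> t q = p ->
  exists V W, [/\ transversal s (p :: V), transversal t (q :: W) &
    uniq ((p :: V) ++ (q :: W))].
Proof.
move=> sp tp tq.
pose rho (b : bool) := if b then s else t.
have sym b := fconnect_sym (@perm_inj _ (rho b)).
(* The nontrivial orbits that avoid p, given by their roots and tagged with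
   the permutation: true for s, false for t. *)
pose A := [set bi : bool * I | [&& froot (rho bi.1) bi.2 == bi.2,
  rho bi.1 bi.2 != bi.2 & ~~ fconnect (rho bi.1) p bi.2]].
pose r (bi : bool * I) k := fconnect (rho bi.1) bi.2 k.
have qp : fconnect t p q by rewrite (sym false) -[X in fconnect _ _ X]tq; apply: fconnect1.
have pNq : p != q by apply: contra tp => /eqP e; rewrite {1}e tq.
have rA b k i : (b, i) \in A -> r (b, i) k -> i = froot (rho b) k.
  rewrite inE => /and3P[/eqP ri _ _]; rewrite /r /= -root_connect //.
  by rewrite ri => /eqP.
have hNp b i : (b, i) \in A -> r (b, i) p = false.
  rewrite inE => /and3P[_ _] /=; rewrite sym; exact: negbTE.
have [|||h [injh hP]] := @hall_degree2 _ _ r snd A (~: [set p; q]).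
- move=> [b i]; rewrite inE => /and3P[_ mi _].
  apply: leq_trans (subset_leq_card (_ : [set i; rho b i] \subset _)).
    by rewrite cards2 eq_sym mi.
  by apply/subsetP=> k; rewrite !inE => /orP[]/eqP->; [apply: connect0 | apply: fconnect1].
- move=> k.
  apply: leq_trans (_ : #|[set (true, froot s k); (false, froot t k)]| <= _).
    apply: subset_leq_card; apply/subsetP=> -[b i]; rewrite in_set => /andP[bA rk].
    by rewrite (rA b k i bA rk) !inE; case: (b); rewrite /= eqxx ?orbT.
  by rewrite cards2; case: eqP.
- rewrite setCK big_setU1 ?inE //= big_set1.
  rewrite [X in X + _](_ : _ = 0) ?add0n; last first.
    apply/eqP; rewrite cards_eq0; apply/eqP/setP=> -[b i]; rewrite in_set in_set0.
    by apply/negP=> /andP[biA]; rewrite (hNp b i).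
  apply: leq_trans (_ : #|[set (true, froot s q)]| <= _); last by rewrite cards1.
  apply: subset_leq_card; apply/subsetP=> -[b i]; rewrite in_set.
  case/andP=> bi rq; rewrite in_set1.
  have bT : b = true.
    case: (b) bi rq => // bi rq; move: (hNp false i bi).
    by rewrite /r /= (connect_trans rq) // (sym false).
  by rewrite (rA b q i bi rq) bT.
pose L b := [seq h (b, i) | i <- enum I & (b, i) \in A].
have Lmem b k : k \in L b -> exists i, [/\ (b, i) \in A, k = h (b, i) & fconnect (rho b) i k].
  case/mapP=> i; rewrite mem_filter => /andP[biA _] ->; exists i.
  by have [_ rh] := hP _ biA.
have Lpq b k : k \in L b -> (k != p) && (k != q).
  case/Lmem=> i [biA -> _]; have [] := hP _ biA.
  by rewrite !inE negb_or.
have Luniq b : uniq (L b).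
  rewrite map_inj_in_uniq; first by apply/filter_uniq/enum_uniq.
  move=> i i'; rewrite !mem_filter => /andP[iA _] /andP[i'A _] e.
  by have [] := injh _ _ iA i'A e.
have tr b u : u \in [set p; q] -> fconnect (rho b) p u -> rho b p != p ->
    transversal (rho b) (u :: L b).
  move=> upq pu mp; apply: transversalP.
  - rewrite /= Luniq andbT; apply/negP=> /Lpq; rewrite -negb_or.
    by move: upq; rewrite !inE => ->.
  - move=> v; rewrite inE => /orP[/eqP->|/Lmem[i [biA _ /fconnect_moved->]]].
      by rewrite (fconnect_moved pu).
    by move: biA; rewrite inE => /and3P[].
  - have uL v : v \in L b -> fconnect (rho b) u v -> False.
      case/Lmem=> i [biA _ iv] uv; move: biA; rewrite inE => /and3P[_ _] /=.
      by rewrite (connect_trans pu) // (connect_trans uv) // sym.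
    move=> v w; rewrite !inE => /orP[/eqP->|vL] /orP[/eqP->|wL] // vw.
    + by case: (uL w).
    + by case: (uL v); rewrite // sym.
    + have [i [iA ve iv]] := Lmem _ _ vL; have [i' [i'A we i'w]] := Lmem _ _ wL.
      rewrite ve we; congr (h (b, _)).
      rewrite (rA b v i) // (rA b w i') //; apply/eqP.
      by rewrite root_connect.
  - move=> k mk; case: (boolP (fconnect (rho b) p k)) => pk.
      exists u; rewrite ?mem_head //; apply: connect_trans pk.
      by rewrite sym.
    have biA : (b, froot (rho b) k) \in A.
      rewrite inE /= (root_root (sym b)) eqxx /=.
      rewrite (fconnect_moved (connect_root _ _)) mk /=.
      by apply: contra pk => pk; apply: connect_trans pk _; rewrite sym connect_root.
    exists (h (b, froot (rho b) k)).
      by rewrite inE map_f ?orbT // mem_filter biA mem_enum.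
    have [_ rh] := hP _ biA; rewrite sym.
    by apply: connect_trans (connect_root _ _) rh.
exists (L true), (L false); split.
- by apply: (tr true); rewrite ?inE ?eqxx.
- by apply: (tr false); rewrite ?inE ?eqxx ?orbT.
have n b k : (k == p) || (k == q) -> k \notin L b.
  by move=> kpq; apply/negP=> /Lpq; rewrite -negb_or kpq.
rewrite cat_uniq; apply/and3P; split.
- by rewrite cons_uniq Luniq n ?eqxx.
- apply/hasPn=> k; rewrite in_cons => /orP[/eqP->|kL] /=.
    by rewrite in_cons negb_or eq_sym pNq n ?eqxx ?orbT.
  rewrite in_cons negb_or; have /andP[-> _] := Lpq _ _ kL.
  apply/negP=> kL'; have [i [iA ve _]] := Lmem _ _ kL.
  have [i' [i'A we _]] := Lmem _ _ kL'.
  by have [] := injh _ _ i'A iA (etrans (esym we) ve).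
- by rewrite cons_uniq Luniq n ?eqxx ?orbT.
Qed.

End Transversal.

(** * Shifting items along permutations of the clusters *)

Section Shift.
Context {T I : finType}.
Implicit Types (f : T -> I) (s t : {perm I}) (x y : I -> T).

(** [s] permutes the clusters and [x i] is the item that leaves cluster [i].  When
    [f (x i) = i] for every cluster [i] moved by [s], the test [j == x (f j)]
    recognises the selected items. *)
Definition shift f s x : T -> I := fun j => if j == x (f j) then s (f j) else f j.

Definition movable f s x := forall i, s i != i -> f (x i) = i.

(** [next_map] for a map that is injective only on the list. *)
Lemma next_map_in (A B : eqType) (h : A -> B) (u : seq A) i :
  uniq (map h u) -> i \in u -> next (map h u) (h i) = h (next u i).
Proof.
move=> /uniq_map_inj inj iu.
case: u inj iu => //= a u inj iu; have au := mem_head a u.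
have inj' k : k \in a :: u -> (h i == h k) = (i == k).
  by move=> ku; apply/eqP/eqP=> [/inj->|->].
suff gen b c : (forall k, k \in c :: u -> (h i == h k) = (i == k)) ->
    next_at (h i) (h b) (h c) (map h u) = h (next_at i b c u) by apply: gen.
elim: (u) c => [|w v IH] c inj2 /=; rewrite inj2 ?mem_head //; case: ifP => // _.
by apply: IH => k ku; apply: inj2; rewrite in_cons ku orbT.
Qed.

Definition item_cycles s x (V : seq I) :=
  [seq map x (orbit s v) | v <- V].

Section One.
Variables (f : T -> I) (s : {perm I}) (x : I -> T) (V : seq I).
Hypotheses (fx : movable f s x) (trV : transversal s V).

Lemma mem_item_cycles j :
  j \in flatten (item_cycles s x V) -> exists i, [/\ s i != i, j = x i & f j = i].
Proof.
case/flatten_mapP=> v vV /mapP[i iv ->]; have mi : s i != i.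
  by rewrite -trV.2; apply/flatten_mapP; exists v.
by exists i; rewrite fx.
Qed.

Lemma map_item_cycles :
  map f (flatten (item_cycles s x V)) = flatten (map (orbit s) V).
Proof.
rewrite map_flatten -map_comp; congr flatten; apply/eq_in_map=> v vV /=.
rewrite -map_comp map_id_in // => i iv /=; apply: fx.
by rewrite -trV.2; apply/flatten_mapP; exists v.
Qed.

Lemma uniq_item_cycles : uniq (map f (flatten (item_cycles s x V))).
Proof. by rewrite map_item_cycles trV.1. Qed.

Lemma nonempty_item_cycles : all (predC1 [::]) (item_cycles s x V).
Proof.
by apply/allP=> u /mapP[v _ ->] /=; rewrite -size_eq0 size_map size_orbit -lt0n fingraph.order_gt0.
Qed.

Lemma next_orbit v i : i \in orbit s v -> next (orbit s v) i = s i.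
Proof.
by move=> iv; have /eqP := next_cycle (cycle_orbit (@perm_inj _ s) v) iv.
Qed.

Lemma comp_item_cycles : f \o cycles (item_cycles s x V) =1 shift f s x.
Proof.
move=> j /=; rewrite /shift.
have [jF|jF] := boolP (j \in flatten (item_cycles s x V)).
  case/flattenP: (jF) => u uC; case/mapP: (uC) => v vV ue ju.
  rewrite (cycles_in (map_uniq uniq_item_cycles) uC ju).
  move: ju; rewrite ue => /mapP[i iv ->].
  have mi : s i != i by rewrite -trV.2; apply/flatten_mapP; exists v.
  have uu : uniq (map x (orbit s v)).
    apply: (@map_uniq _ _ f); rewrite -map_comp map_id_in ?orbit_uniq //.
    move=> k kv /=; apply: fx.
    by rewrite -trV.2; apply/flatten_mapP; exists v.
  rewrite next_map_in // next_orbit // fx //; last by rewrite (inj_eq perm_inj).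
  by rewrite fx // eqxx.
rewrite cycles_notin //; case: eqVneq => // je; apply/esym/eqP.
have [//|mi] := eqVneq (s (f j)) (f j).
move: mi; rewrite -trV.2 => /flatten_mapP[v vV fv]; case/negP: jF.
by apply/flatten_mapP; exists v => //; apply/mapP; exists (f j).
Qed.

End One.

Lemma exchange_eq f1 f2 g1 g2 : f1 =1 f2 -> g1 =1 g2 ->
  @exchange T I f1 g1 -> exchange f2 g2.
Proof.
move=> e1 e2 [u [uu ge]]; exists u; split; first by rewrite -(eq_map e1).
by move=> j; rewrite -e2 ge /= e1.
Qed.

Lemma exchange_refl f : exchange f f.
Proof. by exists [::]. Qed.

Lemma shift_two (x0 : T) f s x : movable f s x ->
  exists2 f1, exchange f f1 & exchange f1 (shift f s x).
Proof.
move=> fx; have [V trV] := exists_transversal s.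
have [f1 e1 e2] := merge_two x0 (nonempty_item_cycles s x V) (uniq_item_cycles fx trV).
by exists f1 => //; apply: exchange_eq e2 => //; apply: comp_item_cycles.
Qed.

(** This saves one of the four exchanges that [shift_two] would give.  If some cluster [p] is moved by both permutations,
    [merge_three] applies with disjoint transversals as list heads, the first
    family starting at [p] and the second one at the cluster that [t] sends
    to [p]; both critical items are then bound for [p].  If the permutations
    move disjoint sets of clusters, together they form a single family of
    disjoint cycles. *)
Lemma shift_three (x0 : T) f s x t y : movable f s x -> movable f t y ->
  (forall i, s i != i -> t i != i -> x i <> y i) ->
  exists f1 f2, [/\ exchange f f1, exchange f1 f2 &
    exchange f2 (shift (shift f s x) t y)].
Proof.
move=> fx fy xy.
have dis V W : transversal s V -> transversal t W ->
  forall j, j \in flatten (item_cycles t y W) -> j \notin flatten (item_cycles s x V).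
  move=> trV trW j /(mem_item_cycles fy trW)[i [mi ji fi]].
  apply/negP=> /(mem_item_cycles fx trV)[i' [mi' ji' fi']].
  by move: mi' ji'; rewrite -fi' fi => mi' /esym; rewrite ji; apply: xy.
have final V W : transversal s V -> transversal t W ->
  f \o cycles (item_cycles s x V) \o cycles (item_cycles t y W)
    =1 shift (shift f s x) t y.
  move=> trV trW j; have e := comp_item_cycles fx trV.
  have fy' : movable (f \o cycles (item_cycles s x V)) t y.
    move=> i mi; rewrite /= cycles_notin ?fy //; apply: (dis _ _ trV trW).
    move: (mi); rewrite -trW.2 => /flatten_mapP[v vW iv].
    by apply/flatten_mapP; exists v => //; apply: map_f.
  by rewrite (comp_item_cycles fy' trW) /shift !e.
have [/existsP[p /andP[sp tp]]|/existsPn dst] :=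
  boolP [exists p, (s p != p) && (t p != p)].
- pose q := (t^-1)%g p; have tq : t q = p by rewrite permKV.
  have [V [W [trV trW uVW]]] := disjoint_transversals sp tp tq.
  have headE z (u : {perm I}) v : head x0 (map z (orbit u v)) = z v :> T.
    by rewrite /orbit -fingraph.orderSpred.
  have mq : t q != q by rewrite -(inj_eq (@perm_inj _ t)) tq.
  have qq : q \in orbit t q by rewrite -fconnect_orbit connect0.
  pose C := item_cycles s x V; pose E := item_cycles t y W.
  have [||||||| f1 [f2 [e1 e2 e3]]] := @merge_three _ _ x0 f
    (map x (orbit s p)) (map y (orbit t q)) C E.
  + exact: (@nonempty_item_cycles s x (p :: V)).
  + exact: (@nonempty_item_cycles t y (q :: W)).
  + exact: uniq_item_cycles fx trV.
  + exact: uniq_item_cycles fy trW.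
  + rewrite cat_uniq (map_uniq (uniq_item_cycles fx trV)).
    rewrite (map_uniq (uniq_item_cycles fy trW)) andbT.
    by apply/hasPn=> j /(dis _ _ trV trW).
  + change (is_true (uniq (map f (map (head x0) (item_cycles s x (p :: V)) ++
      map (head x0) (item_cycles t y (q :: W)))))).
    rewrite map_cat -!map_comp; move: uVW; congr (is_true (uniq (_ ++ _))).
      apply/esym/map_id_in=> v vV /=; rewrite headE fx //.
      rewrite -trV.2; apply/flatten_mapP; exists v => //.
      by rewrite -fconnect_orbit connect0.
    apply/esym/map_id_in=> v vV /=; rewrite headE fy //.
    rewrite -trW.2; apply/flatten_mapP; exists v => //.
    by rewrite -fconnect_orbit connect0.
  + rewrite !headE next_map_in //; last first.
      apply: (@map_uniq _ _ f); rewrite -map_comp map_id_in ?orbit_uniq //.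
      move=> k kv /=; apply: fy; rewrite -trW.2; apply/flatten_mapP.
      by exists q; rewrite ?mem_head.
    by rewrite next_orbit // tq fx // fy.
  exists f1, f2; split=> //; apply: exchange_eq e3 => //; exact: final trV trW.
have [V trV] := exists_transversal s; have [W trW] := exists_transversal t.
have [||f1 e1 e2] := @merge_two _ _ x0 f (item_cycles s x V ++ item_cycles t y W).
- by rewrite all_cat !nonempty_item_cycles.
- rewrite flatten_cat map_cat cat_uniq !uniq_item_cycles //= andbT.
  apply/hasPn=> i; rewrite !map_item_cycles // trW.2 => ti; rewrite /= trV.2.
  by have := dst i; rewrite ti andbT.
exists f1, (shift (shift f s x) t y); split=> //; last exact: exchange_refl.
apply: exchange_eq e2 => // j.
by rewrite -(final _ _ trV trW) /= cycles_cat.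
Qed.

End Shift.

(** * The number of exchanges between two assignments *)

Section Excess.
Context {T I : finType}.
Implicit Types (f g : T -> I).

Definition excess f g i := #|[set j | (f j == i) && (g j != i)]|.

Definition same_sizes f g := forall i,
  #|[set j | f j == i]| = #|[set j | g j == i]|.

Lemma excess_sym f g i : same_sizes f g -> excess g f i = excess f g i.
Proof.
move=> fg; have := fg i; rewrite /excess.
rewrite -(cardsID [set j | g j == i] [set j | f j == i]).
rewrite -(cardsID [set j | f j == i] [set j | g j == i]) setIC => /addnI e.
rewrite -[LHS](@eq_card _ (mem ([set j | g j == i] :\: [set j | f j == i]))).
  by rewrite -e; apply: eq_card => j; rewrite !inE andbC.
by move=> j; rewrite !inE andbC.
Qed.

Lemma excess_sum f g i :
  \sum_(k | k != i) #|[set j | (f j == i) && (g j == k)]| = excess f g i.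
Proof.
rewrite /excess -sum1dep_card (partition_big g (fun k => k != i)) /=; last first.
  by move=> j /andP[].
apply: eq_bigr => k ki; rewrite -sum1dep_card; apply: eq_bigl => j.
by case: eqP => //= _; case: eqVneq => [->|]; rewrite ?andbF ?andbT.
Qed.

Lemma excess_le_size f g i : excess f g i <= #|[set j | f j == i]|.
Proof. by apply: subset_leq_card; apply/subsetP=> j; rewrite !inE => /andP[]. Qed.

Lemma excess0 f g : (forall i, excess f g i = 0) -> f =1 g.
Proof.
move=> e j; apply/esym/eqP; apply: contraT => ne.
have /eqP := e (f j); rewrite cards_eq0 => /eqP/setP/(_ j).
by rewrite !inE eqxx ne.
Qed.

Lemma excess_progress f f1 g i : (forall j, f1 j = f j \/ f1 j = g j) ->
  excess f1 g i <= excess f g i /\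
  ((exists j, [/\ f j = i, g j != i & f1 j = g j]) ->
    excess f1 g i < excess f g i).
Proof.
move=> f1E.
have sub : [set j | (f1 j == i) && (g j != i)] \subset
           [set j | (f j == i) && (g j != i)].
  apply/subsetP=> j; rewrite !inE; case: (f1E j) => -> // /andP[/eqP->].
  by rewrite eqxx.
split=> [|[j [fj gj f1j]]]; first exact: subset_leq_card.
apply: proper_card; rewrite properE sub; apply/subsetPn.
by exists j; rewrite !inE ?fj ?eqxx // f1j (negPf gj).
Qed.

(** The numbers of items to be carried from one cluster to another, completed on
    the diagonal by [D - excess f g i], form a matrix all of whose row and
    column sums equal [D], so its support contains a permutation.  A cluster of
    full excess [D] has diagonal entry 0 and therefore takes part in the
    shift. *)
Lemma exists_shift (t0 : T) f g D : same_sizes f g -> 0 < D ->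
  (forall i, excess f g i <= D) ->
  exists (s : {perm I}) (x : I -> T), [/\ movable f s x,
    forall i, s i != i -> g (x i) = s i &
    forall i, excess f g i = D -> s i != i].
Proof.
move=> fg D0 exD.
(* The entry for k and i counts the items of cluster i that belong in k. *)
pose N (k i : I) := if i == k then D - excess f g i
  else #|[set j | (f j == i) && (g j == k)]|.
have row k : \sum_i N k i = D.
  rewrite (bigD1 k) //= /N eqxx.
  rewrite (eq_bigr (fun i => #|[set j | (g j == k) && (f j == i)]|)).
    by rewrite excess_sum (excess_sym k fg) subnK.
  by move=> i /negPf->; apply: eq_card => j; rewrite !inE andbC.
have col i : \sum_k N k i = D.
  rewrite (bigD1 i) //= /N eqxx.
  rewrite (eq_bigr (fun k => #|[set j | (f j == i) && (g j == k)]|)).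
    by rewrite excess_sum // subnK.
  by move=> k; rewrite eq_sym => /negPf->.
have [||i|k|h injh hP] := @injection_in_support int I I D%:R%R (fun k i => (N k i)%:R%R).
- by rewrite ltr0n.
- by move=> k i; rewrite ler0n.
- by rewrite -natr_sum col.
- by rewrite -natr_sum row.
pose x i := odflt t0 [pick j | (f j == i) && (g j == h i)].
have xP i : h i != i -> f (x i) = i /\ g (x i) = h i.
  move=> hi; rewrite /x; case: pickP => [j /andP[/eqP-> /eqP->] //|n].
  have := hP i; rewrite ltr0n /N eq_sym (negPf hi) card_gt0 => /set0Pn[j].
  by rewrite inE n.
exists (perm injh), x; split=> [i|i|i e]; rewrite permE.
- by move=> /xP[].
- by move=> /xP[].
- by apply: contraTneq (hP i) => ->; rewrite /N eqxx e subnn ltxx.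
Qed.

Lemma exchange_sizes f f1 : exchange f f1 -> same_sizes f f1.
Proof.
case=> u [/map_uniq uu e] i.
rewrite -(card_preimset [set j | f j == i] (next_inj uu)).
by apply: eq_card => j; rewrite !inE e.
Qed.

Lemma same_sizes_trans f g k : same_sizes f g -> same_sizes g k -> same_sizes f k.
Proof. by move=> fg gk i; rewrite fg gk. Qed.

Lemma same_sizes_sym f g : same_sizes f g -> same_sizes g f.
Proof. by move=> fg i; rewrite fg. Qed.

Fixpoint reach k f g : Prop :=
  if k is k'.+1 then exists2 f1, exchange f f1 & reach k' f1 g else f =1 g.

Lemma reachS k f g : reach k f g -> reach k.+1 f g.
Proof. by exists f => //; apply: exchange_refl. Qed.

Section ShiftProgress.
Variables (f g : T -> I) (s : {perm I}) (x : I -> T).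
Hypotheses (fx : movable f s x) (gx : forall i, s i != i -> g (x i) = s i).

Lemma shift_moved i : s i != i -> shift f s x (x i) = g (x i).
Proof. by move=> mi; rewrite /shift fx // eqxx gx. Qed.

Lemma shift_cases j : shift f s x j = f j \/ shift f s x j = g j.
Proof.
rewrite /shift; case: eqVneq => [e|]; last by left.
have [->|m] := eqVneq (s (f j)) (f j); first by left.
by right; rewrite [in RHS]e gx.
Qed.

Lemma excess_shift D : (forall i, excess f g i <= D.+1) ->
  (forall i, excess f g i = D.+1 -> s i != i) ->
  forall i, excess (shift f s x) g i <= D.
Proof.
move=> exD mv i; have [le lt] := excess_progress i shift_cases.
have := exD i; rewrite leq_eqVlt ltnS => /orP[/eqP e|]; last exact: leq_trans.
have mi := mv i e; rewrite -ltnS -e; apply: lt; exists (x i).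
by rewrite shift_moved // fx // gx.
Qed.
End ShiftProgress.

(** Two shifts lower the maximal excess by two and cost three exchanges; for odd
    [D] a last shift costs two. *)
Lemma reach_excess D f g : same_sizes f g -> (forall i, excess f g i <= D) ->
  reach (D + uphalf D) f g.
Proof.
move: {2}D./2.+1 (ltnSn D./2) => n; elim: n D f g => // n IH D f g leDn fg exD.
have [t0 _|T0] := pickP (mem T); last first.
  have fE (f1 : T -> I) : f1 =1 g by move=> j; have := T0 j.
  by elim: (_ + _) => //= k IHk; exists f => //; apply: exchange_refl.
case: D exD leDn => [|[|D]] exD leDn.
- by apply: excess0 => i; apply/eqP; rewrite -leqn0.
- have [s [x [fx gx mv]]] := exists_shift t0 fg (ltn0Sn _) exD.
  have [f1 e1 e2] := shift_two t0 fx.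
  exists f1 => //; exists (shift f s x) => //.
  by apply: excess0 => i; apply/eqP; rewrite -leqn0; apply: excess_shift.
have [s [x [fx gx mv]]] := exists_shift t0 fg (ltn0Sn _) exD.
have ex1 := excess_shift fx gx exD mv.
set f' := shift f s x in ex1.
have f'g : same_sizes f' g.
  have [f1 /exchange_sizes e1 /exchange_sizes e2] := shift_two t0 fx.
  by apply: same_sizes_trans fg; apply/same_sizes_sym/(same_sizes_trans e1 e2).
have [t [y [fy gy mv']]] := exists_shift t0 f'g (ltn0Sn _) ex1.
have ex2 := excess_shift fy gy ex1 mv'.
(* The items of the second shift have not been moved by the first one, whose
   items are already where they belong; so both can be selected in f. *)
have yn i : t i != i -> f' (y i) != g (y i) by move=> mi; rewrite fy // gy // eq_sym.
have fy0 : movable f t y.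
  move=> i mi; rewrite -[RHS](fy i mi); have [//|e] := shift_cases f gx (y i).
  by case/eqP: (yn i mi).
have [|f1 [f2 [e1 e2 e3]]] := shift_three t0 fx fy0.
  move=> i mi mi' e; case/eqP: (yn i mi').
  by rewrite -e; apply: shift_moved.
rewrite (_ : _ + _ = (D + uphalf D).+3); last by rewrite /=; lia.
exists f1 => //; exists f2 => //; exists (shift f' t y) => //.
apply: IH => //.
apply: same_sizes_trans f'g.
have [f3 /exchange_sizes e4 /exchange_sizes e5] := shift_two t0 fy.
exact/same_sizes_sym/(same_sizes_trans e4 e5).
Qed.

(** The items selected along one orbit lie in pairwise distinct clusters, so the
    arcs of this orbit are performed by a single exchange. *)
Lemma exchange_orbit f g (s : {perm I}) (x : I -> T) (i0 : I) : movable f s x ->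
  (forall i, s i != i -> g (x i) = s i) -> s i0 != i0 ->
  exists f1, [/\ exchange f f1, forall j, f1 j = f j \/ f1 j = g j &
    f1 (x i0) = g (x i0)].
Proof.
move=> fx gx mi0; pose u := map x (orbit s i0).
have mv i : i \in orbit s i0 -> s i != i.
  by rewrite -fconnect_orbit => /fconnect_moved->.
have uu : uniq (map f u).
  by rewrite -map_comp map_id_in ?orbit_uniq // => i iO; apply/fx/mv.
have nxt i : i \in orbit s i0 -> f (next u (x i)) = g (x i).
  move=> iO; rewrite next_map_in ?(map_uniq uu) // next_orbit // gx ?mv // fx //.
  by rewrite (inj_eq perm_inj) mv.
exists (f \o next u); split; first by exists u.
  move=> j; have [/mapP[i iO ->]|ju] := boolP (j \in u); first by right; apply: nxt.
  by left; rewrite /= next_notin.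
by apply: nxt; rewrite -fconnect_orbit connect0.
Qed.

(** As long as [i0] has an excess larger than [D], a shift moves [i0], and already
    its orbit through [i0] reduces the excess of [i0] in one exchange without
    increasing any other. *)
Lemma reach_excess_one (i0 : I) e D f g : same_sizes f g ->
  excess f g i0 <= e + D -> (forall i, i != i0 -> excess f g i <= D) ->
  reach (e + (D + uphalf D)) f g.
Proof.
elim: e f => [|e IH] f fg ex0 exD.
  by apply: reach_excess => // i; have [->|/exD] := eqVneq i i0.
move: ex0; rewrite leq_eqVlt => /orP[/eqP ex0|]; last first.
  by rewrite addSn ltnS => ex0; apply/reachS/IH.
have /set0Pn[t0 _] : [set j | (f j == i0) && (g j != i0)] != set0.
  by rewrite -card_gt0 -/(excess f g i0) ex0.
have [|i|s [x [fx gx mv]]] := @exists_shift t0 f g (e.+1 + D) fg; first by [].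
  by have [->|/exD] := eqVneq i i0; rewrite ?ex0 //; lia.
have mi0 := mv i0 ex0.
have [f1 [e1 f1E f1x]] := exchange_orbit fx gx mi0.
exists f1 => //; apply: IH.
- exact: same_sizes_trans (same_sizes_sym (exchange_sizes e1)) fg.
- have [_ lt] := excess_progress i0 f1E; rewrite -ltnS -addSn -ex0; apply: lt.
  by exists (x i0); rewrite f1x fx // gx.
- by move=> i /exD; apply: leq_trans; have [] := excess_progress i f1E.
Qed.

End Excess.

Local Open Scope ring_scope.
Local Open Scope classical_set_scope.

(** * Diameters of graphs *)

Section GraphDiameterBound.
Context {T : Type}.
Implicit Types (A : set T) (r : rel T).

(** Distances are natural numbers, so a uniform bound on them makes their maximum
    exist. *)
Lemma bounded_graph_diameter A r K : A !=set0 ->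
  (forall u v, A u -> A v -> exists2 k, walk r u v k & (k <= K)%N) ->
  exists2 D, graph_diameter A r D & (D <= K)%N.
Proof.
move=> [a Aa] bound.
have dist u v : A u -> A v -> exists2 k, graph_distance r u v k & (k <= K)%N.
  move=> Au Av; have [k wk kK] := bound u v Au Av.
  have ex : exists k, `[< walk r u v k >] by exists k; apply/asboolP.
  case: (ex_minnP ex) => l /asboolP wl minl.
  exists l; last by apply: leq_trans kK; apply: minl; apply/asboolP.
  by split=> // l' wl'; apply: minl; apply/asboolP.
pose Q k := `[< exists u v, [/\ A u, A v & graph_distance r u v k] >].
have exQ : exists k, Q k.
  by have [k dk _] := dist a a Aa Aa; exists k; apply/asboolP; exists a, a.
have unique u v k l : graph_distance r u v k -> graph_distance r u v l -> k = l.
  by move=> [wk mk] [wl ml]; apply/eqP; rewrite eqn_leq mk // ml.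
have ubQ k : Q k -> (k <= K)%N.
  move=> /asboolP[u [v [Au Av duv]]]; have [l dl lK] := dist u v Au Av.
  by rewrite (unique _ _ _ _ duv dl).
case: (ex_maxnP exQ ubQ) => D QD maxD.
exists D; last exact: ubQ.
split; last exact/asboolP.
move=> u v Au Av; have [k dk _] := dist u v Au Av; exists k => //.
by apply: maxD; apply/asboolP; exists u, v.
Qed.

End GraphDiameterBound.

(** * Vertices and edges of the partition polytope *)

Section Polytope.
Variables (R : realType) (n : nat) (kappa : 'I_n -> nat).
Notation m := (\sum_(i < n) kappa i)%N.
Notation P := (partition_polytope R kappa).
Implicit Types (f g : 'I_m -> 'I_n) (y : 'M[R]_(n, m)).

Definition vertex_of f : 'M[R]_(n, m) := \matrix_(i, j) (f j == i)%:R.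

Definition clustering f := forall i, #|[set j | f j == i]%SET| = kappa i.

Lemma vertex_of_sum f i : \sum_j vertex_of f i j = #|[set j | f j == i]%SET|%:R.
Proof.
rewrite -sum1dep_card natr_sum [RHS]big_mkcond /=.
by apply: eq_bigr => j _; rewrite mxE; case: eqP.
Qed.

Lemma vertex_of_polytope f : clustering f -> P (vertex_of f).
Proof.
move=> fk; split=> [i|j|i j].
- by rewrite vertex_of_sum fk.
- by rewrite (bigD1 (f j)) //= mxE eqxx big1 ?addr0 // => i ne; rewrite mxE eq_sym (negPf ne).
- by rewrite mxE ler0n.
Qed.

Lemma vertex_of_inj f g : vertex_of f = vertex_of g -> f =1 g.
Proof.
move=> e j; move/matrixP/(_ (f j) j): e; rewrite !mxE eqxx.
by case: eqP => // _ /eqP; rewrite oner_eq0.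
Qed.

Lemma vertex_of_ext f g : f =1 g -> vertex_of f = vertex_of g.
Proof. by move=> e; apply/matrixP=> i j; rewrite !mxE e. Qed.

(** Splitting row [i] into [kappa i] equal rows turns [y] into a doubly stochastic
    matrix; a permutation in its support is an assignment with the right
    cluster sizes. *)
Lemma clustering_in_support y : P y ->
  exists2 f, clustering f & forall j, 0 < y (f j) j.
Proof.
move=> [row col y0].
have row0 i j : kappa i = 0%N -> y i j = 0.
  move=> k0; apply/eqP; have := row i; rewrite k0 => /eqP.
  by rewrite psumr_eq0 // => /allP/(_ j); rewrite mem_index_enum => /(_ isT).
pose S : finType := {i : 'I_n & 'I_(kappa i)}.
have [||j|[i k]|h injh hP] := @injection_in_support R S 'I_m 1
    (fun t j => y (tag t) j / (kappa (tag t))%:R).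
- exact: ltr01.
- by move=> t j; rewrite divr_ge0 // ler0n.
- rewrite -(@sig_big_dep _ _ _ _ _ xpredT (fun _ => xpredT)
    (fun i _ => y i j / (kappa i)%:R)) /= -[RHS](col j).
  apply: eq_bigr => i _; rewrite sumr_const card_ord.
  case: (posnP (kappa i)) => [k0|kp]; first by rewrite k0 mulr0n row0.
  by rewrite -[LHS]mulr_natr mulfVK // pnatr_eq0 -lt0n.
- rewrite /= -mulr_suml row ler_pdivrMr ?mul1r // ltr0n.
  exact: leq_ltn_trans (ltn_ord k).
pose f j := tag (h j).
have f_le i : (#|[set j | f j == i]%SET| <= kappa i)%N.
  rewrite -(card_imset _ injh).
  apply: (@leq_trans #|[set Tagged (fun i => 'I_(kappa i)) k | k : 'I_(kappa i)]%SET|).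
    apply: subset_leq_card; apply/fintype.subsetP=> t /imsetP[j].
    rewrite inE /f => + ->; case: (h j) => i' k /= /eqP e.
    by case: _ / e k => k; apply: imset_f.
  by apply: leq_trans (leq_imset_card _ _) _; rewrite card_ord.
have sum_f : (\sum_i #|[set j | f j == i]%SET| = m)%N.
  rewrite -[RHS](card_ord m) -sum1_card (partition_big f xpredT) //=.
  by apply: eq_bigr => i _; rewrite sum1dep_card.
exists f => [i|j].
  apply/eqP; rewrite eqn_leq f_le /= leqNgt; apply/negP=> lt.
  have : (\sum_i #|[set j | f j == i]%SET| < m)%N.
    rewrite (bigD1 i) //= [ltnRHS](bigD1 i) //= -addSn leq_add //.
    by apply: leq_sum => i' _.
  by rewrite sum_f ltnn.
have := hP j; case: (posnP (kappa (tag (h j)))) => [->|kp].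
  by rewrite invr0 mulr0 ltxx.
by rewrite pmulr_lgt0 // invr_gt0 ltr0n.
Qed.

Lemma exists_clustering : exists f, clustering f.
Proof.
(* The barycentre of the polytope supports some clustering. *)
suff /clustering_in_support[f ? _] :
  P (\matrix_(i, j) ((kappa i)%:R / m%:R)) by exists f.
split=> [i|j|i j].
- under eq_bigr do rewrite mxE.
  rewrite sumr_const card_ord.
  case: (posnP m) => [m0|mp].
    rewrite m0 mulr0n; have : (kappa i <= m)%N by rewrite (bigD1 i) //= leq_addr.
    by rewrite m0 leqn0 => /eqP->.
  by rewrite -[LHS]mulr_natr mulfVK // pnatr_eq0 -lt0n.
- under eq_bigr do rewrite mxE.
  rewrite -mulr_suml -natr_sum divff // pnatr_eq0 -lt0n.
  exact: leq_ltn_trans (ltn_ord j).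
- by rewrite mxE divr_ge0 // ler0n.
Qed.

Section Mask.
Variable (M : 'I_n -> 'I_m -> bool).

(** A linear form that is at most 0 on the polytope, with equality exactly where
    the entries outside the mask [M] vanish. *)
Definition off_mask y : R := \sum_i \sum_(j | ~~ M i j) - y i j.

Lemma off_mask_linear : scalar off_mask.
Proof.
move=> a u v; rewrite /off_mask mulr_sumr -big_split /=; apply: eq_bigr => i _.
rewrite mulr_sumr -big_split /=; apply: eq_bigr => j _.
by rewrite !mxE; ring.
Qed.

HB.instance Definition _ :=
  GRing.isLinear.Build R 'M[R]_(n, m) R *%R off_mask off_mask_linear.

Definition masked : set 'M[R]_(n, m) :=
  [set y | P y /\ forall i j, ~~ M i j -> y i j = 0].

Lemma face_masked : face P masked.
Proof.
exists off_mask, 0; split.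
  move=> y [_ _ y0]; apply: sumr_le0 => i _; apply: sumr_le0 => j _.
  by rewrite oppr_le0.
apply/seteqP; split=> y [Py yM]; split=> //.
  by apply: big1 => i _; apply: big1 => j /yM->; rewrite oppr0.
have [_ _ y0] := Py; move=> i j Mij; move/eqP: yM.
rewrite -oppr_eq0 /= /off_mask -sumrN.
have nn k : 0 <= - \sum_(j | ~~ M k j) - y k j.
  by rewrite sumrN opprK sumr_ge0.
rewrite psumr_eq0 // => /allP/(_ i); rewrite mem_index_enum => /(_ isT) /=.
rewrite sumrN opprK psumr_eq0 // => /allP/(_ j).
by rewrite mem_index_enum Mij => /(_ isT) /eqP.
Qed.

End Mask.

Lemma vertices_vertex_of f : clustering f -> vertices P (vertex_of f).
Proof.
move=> fk; exists (masked (fun i j => f j == i)); split.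
- exact: face_masked.
- have single y : masked (fun i j => f j == i) y -> y = vertex_of f.
    move=> [[_ col _] yM]; apply/matrixP=> i j; rewrite mxE.
    case: eqP => [<-|/eqP ne]; last exact: yM.
    rewrite -(col j) [in RHS](bigD1 (f j)) //= [X in _ + X]big1 ?addr0 // => k.
    by rewrite eq_sym => /yM.
  split.
    exists (vertex_of f); split; first exact: vertex_of_polytope.
    by move=> i j; rewrite mxE => /negPf->.
  exists 0%VS; split; first exact: dimv0.
    by move=> x y /single-> /single->; rewrite subrr mem0v.
  by move=> W _; apply: sub0v.
- by split; [exact: vertex_of_polytope | move=> i j; rewrite mxE => /negPf->].
Qed.

(** Integrality of the vertices.  Take a clustering [f] in the support of the
    vertex [v].  The point [v + eps *: (v - vertex_of f)] is still in the polytope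
    for a small [eps], so a linear form which is maximal at [v] is also maximal
    at [vertex_of f]; hence [vertex_of f] lies in the zero-dimensional face
    of [v]. *)
Lemma vertex_is_clustering v :
  vertices P v -> exists2 f, clustering f & v = vertex_of f.
Proof.
move=> [F [[c [b [cP FE]]] [_ [U [U0 dU _]]] Fv]].
have [Pv cv] : P v /\ c v = b by move: Fv; rewrite FE.
have [f fk fpos] := clustering_in_support Pv; exists f => //.
have Pf := vertex_of_polytope fk.
pose eps := \big[Num.min/1]_j v (f j) j.
have eps0 : 0 < eps by apply: lt_bigmin => [|j _]; rewrite ?ltr01.
have epsle j : eps <= v (f j) j by apply: bigmin_le_cond.
have Pw : P (v + eps *: (v - vertex_of f)).
  have [rv cov v0] := Pv; have [rf cof f0] := Pf; split=> [i|j|i j].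
  - under eq_bigr do rewrite !mxE.
    have rf' : \sum_j (f j == i)%:R = (kappa i)%:R :> R.
      by rewrite -[RHS](rf i); apply: eq_bigr => j _; rewrite mxE.
    by rewrite big_split /= -mulr_sumr sumrB rv rf' subrr mulr0 addr0.
  - under eq_bigr do rewrite !mxE.
    have cof' : \sum_i (f j == i)%:R = 1 :> R.
      by rewrite -[RHS](cof j); apply: eq_bigr => i _; rewrite mxE.
    by rewrite big_split /= -mulr_sumr sumrB cov cof' subrr mulr0 addr0.
  - rewrite !mxE; have := v0 i j; case: eqP => [<- _|_ vij].
      have := epsle j; have := mulr_ge0 (ltW eps0) (v0 (f j) j).
      by rewrite mulrBr mulr1 => *; lra.
    by rewrite subr0 addr_ge0 // mulr_ge0 // ltW.
have cf : c (vertex_of f) = b.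
  apply/eqP; rewrite eq_le cP //=.
  have := cP _ Pw; rewrite linearD linearZ linearB /= cv.
  rewrite gerDl pmulr_rle0 // subr_le0; exact.
have : v - vertex_of f \in U by apply: dU; rewrite FE.
move/eqP: U0; rewrite dimv_eq0 => /eqP->.
by rewrite memv0 subr_eq0 => /eqP.
Qed.

Lemma next_neq (T : eqType) (s : seq T) (x : T) :
  uniq s -> (1 < size s)%N -> x \in s -> next s x != x.
Proof.
move=> us ss xs; have [i s' e] := rot_to xs.
rewrite -(next_rot i us) e; move: us ss; rewrite -(rot_uniq i) -(size_rot i) e.
case: s' {e} => // z s' /= /andP[]; rewrite inE negb_or eqxx eq_sym.
by case/andP.
Qed.

(** Consider the face of the matrices supported where [vertex_of f] or
    [vertex_of g] is nonzero.  In such a matrix the row sum at the target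
    cluster of a moved item shows that the mass [y (g j) j] already transferred
    is the same for [j] and for its successor in the cycle.  It is therefore
    constant along the cycle, so that the face is a segment. *)
Lemma exchange_edge f g : clustering f -> exchange f g -> ~ f =1 g ->
  edge_adj P (vertex_of f) (vertex_of g).
Proof.
move=> fk fg fNg.
have gk : clustering g by move=> i; rewrite -(exchange_sizes fg) fk.
have [s [ufs gE]] := fg; have us := map_uniq ufs.
have injs := uniq_map_inj ufs.
pose M i j := (f j == i) || (g j == i).
have ss : (1 < size s)%N.
  rewrite ltnNge; apply/negP=> s1; apply: fNg => j; rewrite gE /=.
  by case: (s) s1 => [|a [|]] //= _; case: eqVneq => [->|].
have fNgs j : j \in s -> f j != g j.
  move=> js; rewrite gE /=; apply: contra (next_neq us ss js) => /eqP e.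
  by apply/eqP/esym/injs; rewrite ?mem_next.
have gs j : j \notin s -> g j = f j by move=> js; rewrite gE /= next_notin.
have fM y i j : masked M y -> f j != i -> g j != i -> y i j = 0.
  by move=> [_ yM] fi gi; apply: yM; rewrite negb_or fi gi.
have fix_col y j : masked M y -> j \notin s -> y (f j) j = 1.
  move=> My js; have [[_ col _] _] := My; rewrite -(col j) [in RHS](bigD1 (f j)) //=.
  rewrite [X in _ + X]big1 ?addr0 // => i; rewrite eq_sym => ne.
  by apply: fM; rewrite ?gs.
have mov_col y j : masked M y -> j \in s -> y (f j) j = 1 - y (g j) j.
  move=> My js; have [[_ col _] _] := My.
  suff e : \sum_i y i j = y (f j) j + y (g j) j by rewrite -(col j) e addrK.
  rewrite (bigD1 (f j)) //=; congr (_ + _).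
  rewrite (bigD1 (g j)) 1?eq_sym ?fNgs //= -[RHS]addr0.
  congr (_ + _); apply: big1 => i /andP[].
  by rewrite eq_sym => fi; rewrite eq_sym => gi; apply: fM.
have flow y j : masked M y -> j \in s -> y (g (next s j)) (next s j) = y (g j) j.
  move=> My js; have [[row _ _] _] := My; set k := next s j.
  have ks : k \in s by rewrite mem_next.
  have fkE : f k = g j by rewrite gE.
  have := row (g j); rewrite -fk -vertex_of_sum => /eqP; rewrite -subr_eq0 -sumrB => /eqP.
  have kj : k != j by apply: next_neq.
  rewrite (bigD1 j) //= (bigD1 k) //= [X in _ + (_ + X) = 0]big1 ?addr0.
    rewrite !mxE (negPf (fNgs j js)) fkE eqxx subr0 /=.
    by have := mov_col y k My ks; rewrite fkE => ->; lra.
  move=> l /andP[lj lk]; rewrite mxE.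
  have [ls|ls] := boolP (l \in s).
    have fl : f l != g j.
      by rewrite -fkE; apply: contra lk => /eqP e; apply/eqP/injs.
    rewrite (negPf fl) subr0; apply: fM => //.
    rewrite !gE /=; apply: contra lj => /eqP e; apply/eqP/(next_inj us)/injs => //;
    by rewrite mem_next.
  case: eqP => [<-|/eqP fl]; first by rewrite fix_col ?subrr.
  by rewrite subr0; apply: fM; rewrite // (gs l).
have [j0 j0s] : exists j0, j0 \in s by case: (s) ss => // a *; exists a; apply: mem_head.
have onseg y : masked M y -> y = vertex_of f + y (g j0) j0 *: (vertex_of g - vertex_of f).
  move=> My; have const j : j \in s -> y (g j) j = y (g j0) j0.
    rewrite -(fconnect_cycle (cycle_next us) j0s) => /iter_findex <-.
    elim: (findex _ _ _) => //= k <-; apply: flow => //.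
    by elim: k => //= k; rewrite mem_next.
  apply/matrixP=> i j; rewrite !mxE.
  have [js|js] := boolP (j \in s); last first.
    rewrite (gs j) // subrr mulr0 addr0; case: eqP => [<-|/eqP ne]; first exact: fix_col.
    by apply: fM; rewrite // gs.
  case: (eqVneq (f j) i) => [<-|fi].
    rewrite mov_col // const // eq_sym (negPf (fNgs j js)) /=; ring.
  case: (eqVneq (g j) i) => [<-|gi]; first by rewrite const //=; ring.
  by rewrite fM //=; ring.
have Mf : masked M (vertex_of f).
  split; first exact: vertex_of_polytope.
  by move=> i j; rewrite negb_or mxE => /andP[/negPf->].
have Mg : masked M (vertex_of g).
  split; first exact: vertex_of_polytope.
  by move=> i j; rewrite negb_or mxE => /andP[_ /negPf->].
apply/asboolP; split; [exact: vertices_vertex_of|exact: vertices_vertex_of| |].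
  by move/vertex_of_inj.
exists (masked M); split=> //; first exact: face_masked.
split; first by exists (vertex_of f).
exists <[vertex_of g - vertex_of f]>%VS; split.
- rewrite dim_vline subr_eq0; case: eqP => // /vertex_of_inj e.
  by case: fNg => j; rewrite e.
- move=> x y /onseg ex /onseg ey.
  have -> : x - y = (x (g j0) j0 - y (g j0) j0) *: (vertex_of g - vertex_of f).
    by rewrite {1}ex {1}ey opprD addrACA subrr add0r scalerBl.
  by rewrite memvZ // memv_line.
- by move=> W WF; rewrite -memvE; apply: WF.
Qed.

Lemma reach_walk k f g : clustering f -> reach k f g ->
  exists2 l, walk (edge_adj P) (vertex_of f) (vertex_of g) l & (l <= k)%N.
Proof.
elim: k f => [|k IH] f fk /=.
  by move=> /vertex_of_ext->; exists 0%N => //; exists [::].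
move=> [f1 e1 r1].
have f1k : clustering f1 by move=> i; rewrite -(exchange_sizes e1) fk.
have [l [w [sw pw lw]] lk] := IH f1 f1k r1.
have [/vertex_of_ext->|ne] := pselect (f =1 f1).
  by exists l; [exists w | apply: leqW].
exists l.+1; last by [].
exists (vertex_of f1 :: w); split=> /=; [by rewrite sw| |by []].
by rewrite pw andbT; apply: exchange_edge.
Qed.

End Polytope.

Theorem theorem1p1 (R : realType) (n : nat) (hn : (1 < n)%N)
    (kappa : 'I_n -> nat)
    (hkappa : forall i j : 'I_n, (i <= j)%N -> (kappa j <= kappa i)%N) :
  exists2 D : nat,
    combinatorial_diameter (partition_polytope R kappa) D &
    (D <= kappa (Ordinal (ltnW hn)) + uphalf (kappa (Ordinal hn)))%N.
Proof.
set i0 := Ordinal (ltnW hn); set i1 := Ordinal hn.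
apply: bounded_graph_diameter.
  have [f fk] := exists_clustering R kappa; exists (vertex_of R f).
  exact: vertices_vertex_of.
move=> u v /vertex_is_clustering[f fk ->] /vertex_is_clustering[g gk ->].
have k10 : (kappa i1 <= kappa i0)%N by apply: hkappa.
rewrite -(subnK k10) -addnA; apply: reach_walk => //.
apply: (@reach_excess_one _ _ i0).
- by move=> i; rewrite fk gk.
- by rewrite subnK // -fk excess_le_size.
- move=> i ne; apply: leq_trans (excess_le_size _ _ _) _; rewrite fk.
  by apply: hkappa; rewrite /= lt0n; apply: contra ne.
Qed.
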